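(* Let $\mathfrak{F}=\langle W,R\rangle$ be an $\mathbf{S4}$ frame (i.e. $R$ is reflexive and transitive). Then $\mathfrak{F}$ validates the formula \[\boldsymbol{su} = ((\neg p\to q)\land(\neg q\to p) \rightarrow r \vee s) \to ( p \rightarrow r) \vee(q \rightarrow s)\] if and only if $\mathfrak{F}$ satisfies $(su_2)$.
   Context: Formulas are built from propositional variables $p,q,r,s,\dots$ and $\bot$ with $\land,\lor,\to$; $\neg\alpha$ abbreviates $\alpha\to\bot$. $\mathfrak{F}$ validates a formula if it is true at every point of $\mathfrak{F}$ under every upward-closed (monotonic) valuation, using the standard intuitionistic Kripke semantics. For $X\subseteq W$ put $\mathord{\uparrow}X=\{w\in W:\exists x\in X,\ xRw\}$, $\Diamond X=\{w\in W:\exists x\in X,\ wRx\}$, $\Box X=\{w\in W:\forall v\,(wRv\Rightarrow v\in X)\}$. For $n\ge1$ and $z,x_0,\dots,x_{n-1}\in W$, say $z$ strongly unites $x_0,\dots,x_{n-1}$ if for every $i<n$: $zRx_i$ and $z\in\Box\big(\mathord{\uparrow}\{x_i\}\cup\bigcup_{i'\in n\setminus\{i\}}\Diamond\mathord{\uparrow}\{x_{i'}\}\big)$. The frame satisfies $(su_n)$ if for every $w\in W$ and all $x_0,\dots,x_{n-1}$ with $wRx_i$ for all $i$, there is $z$ with $wRz$ such that $z$ strongly unites $x_0,\dots,x_{n-1}$. *)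

(* Defs.v *)
From mathcomp Require Import all_boot all_classical.

Set Implicit Arguments.
Unset Strict Implicit.
Unset Printing Implicit Defensive.

Local Open Scope classical_set_scope.

Inductive formula : Type :=
| Var of nat
| Bot
| And of formula & formula
| Or of formula & formula
| Imp of formula & formula.

Definition Neg (a : formula) : formula := Imp a Bot.

Section Frames.
Variables (W : Type) (R : W -> W -> Prop).

Definition upset (X : set W) : set W := [set w | exists2 x, X x & R x w].
Definition dia (X : set W) : set W := [set w | exists2 x, X x & R w x].
Definition box (X : set W) : set W := [set w | forall v, R w v -> X v].

Definition monotonic (V : nat -> set W) : Prop :=
  forall k w v, R w v -> V k w -> V k v.

Fixpoint forces (V : nat -> set W) (w : W) (a : formula) : Prop :=
  match a with
  | Var k => V k w
  | Bot => False
  | And b c => forces V w b /\ forces V w c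
  | Or b c => forces V w b \/ forces V w c
  | Imp b c => forall v, R w v -> forces V v b -> forces V v c
  end.

Definition validates (a : formula) : Prop :=
  forall V, monotonic V -> forall w, forces V w a.

Definition strongly_unites (n : nat) (z : W) (x : 'I_n -> W) : Prop :=
  forall i : 'I_n,
    R z (x i) /\
    box (upset [set x i] `|`
         \bigcup_(j in [set j | j <> i]) dia (upset [set x j])) z.

(* Meant for n >= 1. *)
Definition su_cond (n : nat) : Prop :=
  forall (w : W) (x : 'I_n -> W), (forall i, R w (x i)) ->
    exists2 z, R w z & strongly_unites z x.

End Frames.

Definition su_formula : formula :=
  let p := Var 0 in let q := Var 1 in let r := Var 2 in let s := Var 3 in
  Imp (Imp (And (Imp (Neg p) q) (Imp (Neg q) p)) (Or r s))
      (Or (Imp p r) (Imp q s)).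

(* Main.v *)
(** If [su] is refuted at [w], there are successors [x0] of [w] forcing [p] but
    not [r], and [x1] forcing [q] but not [s]; a point strongly uniting them
    forces both premises of [r \/ s] but neither disjunct.  Conversely, given
    [x0] and [x1], interpret [p], [q] as the cones above [x0], [x1] and [r], [s]
    as the sets of points not seeing [x0], [x1]: a point refuting the premise of
    [su] strongly unites [x0] and [x1]. *)
Require Import Defs.
From Stdlib Require Import RelationClasses.
From mathcomp Require Import all_boot all_classical.

Lemma ord2_cases (i : 'I_2) : i = ord0 \/ i = ord_max.
Proof. by case: i => [[|[|//]] lti]; [left|right]; apply: val_inj. Qed.

(** With two indices, the union over [j <> i] has a single term, so each box condition becomes a
    plain disjunction. *)
Lemma strongly_unites2P (W : Type) (R : W -> W -> Prop) (z : W)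
    (x : 'I_2 -> W) :
  strongly_unites R z x <->
  [/\ R z (x ord0), R z (x ord_max),
      forall v, R z v ->
        R (x ord0) v \/ exists2 t, R (x ord_max) t & R v t &
      forall v, R z v ->
        R (x ord_max) v \/ exists2 t, R (x ord0) t & R v t].
Proof.
split=> [uz | [z0 z1 box0 box1] i].
- have [z0 box0] := uz ord0; have [z1 box1] := uz ord_max.
  split=> // v zv.
  + case: (box0 v zv) => [[_ -> ?]|[j /= j0 [t [_ -> xt] vt]]]; first by left.
    right; exists t => //.
    by case: (ord2_cases j) j0 xt => ->.
  + case: (box1 v zv) => [[_ -> ?]|[j /= j1 [t [_ -> xt] vt]]]; first by left.
    right; exists t => //.
    by case: (ord2_cases j) j1 xt => ->.
- case: (ord2_cases i) => ->; split=> // v zv.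
  + case: (box0 v zv) => [xv|[t xt vt]]; first by left; exists (x ord0).
    by right; exists ord_max => //; exists t => //; exists (x ord_max).
  + case: (box1 v zv) => [xv|[t xt vt]]; first by left; exists (x ord_max).
    by right; exists ord0 => //; exists t => //; exists (x ord0).
Qed.

Lemma su_cond2_validates (W : Type) (R : W -> W -> Prop) :
  su_cond R 2 -> validates R su_formula.
Proof.
move=> su V mono w /= v _ prem.
apply: contrapT => /not_orP[/existsNP[x0 /not_implyP[vx0 /not_implyP[p0 nr0]]]
  /existsNP[x1 /not_implyP[vx1 /not_implyP[q1 ns1]]]].
pose x (i : 'I_2) := if i == ord0 then x0 else x1.
have vx i : R v (x i) by rewrite /x; case: ifP.
have [z vz /strongly_unites2P[/= z0 z1 box0 box1]] := su v x vx.
have [|rz|sz] := prem z vz.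
(* If [u] forces the negation of [p], it sees no point above [x0], so [box1] puts it above [x1],
   where [q] persists; [box0] serves the symmetric implication. *)
- split=> u zu nu.
  + case: (box1 u zu) => [xu|[t xt ut]]; first exact: mono xu q1.
    by case: (nu t ut); apply: mono xt p0.
  + case: (box0 u zu) => [xu|[t xt ut]]; first exact: mono xu p0.
    by case: (nu t ut); apply: mono xt q1.
- exact/nr0/(mono _ _ _ z0).
- exact/ns1/(mono _ _ _ z1).
Qed.

Lemma validates_su_cond2 (W : Type) (R : W -> W -> Prop)
    (Rrefl : Reflexive R) (Rtrans : Transitive R) :
  validates R su_formula -> su_cond R 2.
Proof.
move=> valid w x wx.
pose V k : set W := match k with
  | 0 => R (x ord0) | 1 => R (x ord_max)
  | 2 => fun v => ~ R v (x ord0) | _ => fun v => ~ R v (x ord_max) end.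
have mono : monotonic R V.
  move=> [|[|[|k]]] u v uv /=.
  - by move=> xu; apply: Rtrans xu uv.
  - by move=> xu; apply: Rtrans xu uv.
  - by move=> nu vx; apply: nu; apply: Rtrans uv vx.
  - by move=> nu vx; apply: nu; apply: Rtrans uv vx.
apply: contrapT => nz.
have /= /(_ _ (Rrefl w)) := valid V mono w.
(* Both disjuncts of the conclusion fail at [w]: each [x i] lies in its own cone but sees itself. *)
case; last 2 first.
- by move/(_ _ (wx ord0) (Rrefl _)); apply; apply: Rrefl.
- by move/(_ _ (wx ord_max) (Rrefl _)); apply; apply: Rrefl.
move=> z wz [/= npq nqp]; apply: contrapT.
move=> /not_orP[/contrapT z0 /contrapT z1]; apply: nz.
exists z => //; apply/strongly_unites2P; split=> // u zu.
(* If [u] sees nothing in the cone of [x ord_max], it forces the negation of [q], so [nqp] yields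
   [p], that is, [u] is above [x ord0]. *)
- case: (pselect (exists2 t, R (x ord_max) t & R u t)) => [|nt]; first by right.
  by left; apply: nqp => // t ut xt; apply: nt; exists t.
- case: (pselect (exists2 t, R (x ord0) t & R u t)) => [|nt]; first by right.
  by left; apply: npq => // t ut xt; apply: nt; exists t.
Qed.

Theorem theorem1 (W : Type) (R : W -> W -> Prop)
    (Rrefl : Reflexive R) (Rtrans : Transitive R) :
  validates R su_formula <-> su_cond R 2.
Proof.
by split; [apply: validates_su_cond2 | apply: su_cond2_validates].
Qed.
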